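(* Let $k$ and $n$ be positive integers, let $x_1,x_2,\ldots,x_{k+1}$ be real numbers and let $q>0$ be a real number with $q\neq 1$. For nonnegative integers $r_1,\ldots,r_k$ with $\sum_{i=1}^k r_i\le n$ put $s_j=\sum_{i=1}^j r_i$ for $j=1,\ldots,k$ and $r_{k+1}=n-s_k$; also put $z_j=\sum_{i=j+1}^{k+1}x_i$ for $j=1,\ldots,k$. Then the following four identities hold, where each sum extends over all $r_j\in\{0,1,\ldots,n\}$, $j=1,\ldots,k$, with $\sum_{i=1}^k r_i\le n$: $$[x_1+x_2+\cdots+x_{k+1}]_{n,q}=\sum\begin{bmatrix}n\\ r_1,r_2,\ldots,r_k\end{bmatrix}_q q^{\sum_{j=1}^{k}(n-s_j)(x_j-r_j)}\prod_{j=1}^{k+1}[x_j]_{r_j,q},$$ $$[x_1+x_2+\cdots+x_{k+1}+n-1]_{n,q}=\sum\begin{bmatrix}n\\ r_1,r_2,\ldots,r_k\end{bmatrix}_q q^{\sum_{j=1}^{k}r_jz_j}\prod_{j=1}^{k+1}[x_j+r_j-1]_{r_j,q},$$ $$[x_1+x_2+\cdots+x_{k+1}]_{n,q}=\sum\begin{bmatrix}n\\ r_1,r_2,\ldots,r_k\end{bmatrix}_q q^{\sum_{j=1}^{k}r_j(z_j-(n-s_j))}\prod_{j=1}^{k+1}[x_j]_{r_j,q},$$ $$[x_1+x_2+\cdots+x_{k+1}+n-1]_{n,q}=\sum\begin{bmatrix}n\\ r_1,r_2,\ldots,r_k\end{bmatrix}_q q^{\sum_{j=1}^{k}x_j(n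-s_j)}\prod_{j=1}^{k+1}[x_j+r_j-1]_{r_j,q}.$$
   Context: For real $x$ and real $q>0$, $q\ne1$: the $q$-number is $[x]_q=(1-q^x)/(1-q)$; the $q$-factorial of $x$ of order $r$ is $[x]_{r,q}=[x]_q[x-1]_q\cdots[x-r+1]_q$ for $r=1,2,\ldots$, and $[x]_{0,q}=1$; and $[r]_q!=[1]_q[2]_q\cdots[r]_q$ (with $[0]_q!=1$). The $q$-multinomial coefficient is $$\begin{bmatrix}x\\ r_1,r_2,\ldots,r_k\end{bmatrix}_q=\frac{[x]_{r_1+r_2+\cdots+r_k,q}}{[r_1]_q![r_2]_q!\cdots[r_k]_q!}$$ for nonnegative integers $r_1,\ldots,r_k$. *)

(* Defs.v *)
From mathcomp Require Import all_boot all_order all_algebra.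
From mathcomp Require Import reals exp.

Set Implicit Arguments.
Unset Strict Implicit.
Unset Printing Implicit Defensive.

Import Order.TTheory GRing.Theory Num.Theory.
Local Open Scope ring_scope.

Definition qnum (R : realType) (q x : R) : R := (1 - q `^ x) / (1 - q).

(* [x]_{r,q} = [x]_q [x-1]_q ... [x-r+1]_q, for real x *)
Definition qffact (R : realType) (q x : R) (r : nat) : R :=
  \prod_(0 <= i < r) qnum q (x - i%:R).

Definition qfact (R : realType) (q : R) (r : nat) : R :=
  \prod_(1 <= i < r.+1) qnum q i%:R.

Definition qmultinom (R : realType) (q x : R) (k : nat) (r : 'I_k -> nat) : R :=
  qffact q x (\sum_(i < k) r i)%N / \prod_(i < k) qfact q (r i).

(* Indices are 0-based: 'I_k stands for {1, ..., k} and 'I_k.+1 for            *)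
(* {1, ..., k+1}, so j : 'I_k is the index j+1 of the usual 1-based notation. *)

(* s_j = r_1 + ... + r_j *)
Definition psum (k : nat) (r : 'I_k -> nat) (j : 'I_k) : nat :=
  (\sum_(i < k | i <= j) r i)%N.

(* z_j = x_{j+1} + ... + x_{k+1} *)
Definition tailsum (R : realType) (k : nat) (x : 'I_k.+1 -> R) (j : 'I_k) : R :=
  \sum_(i < k.+1 | (j < i)%N) x i.

(* (r_1, ..., r_k) extended by r_{k+1} = n - (r_1 + ... + r_k); the           *)
(* subtraction is truncated, so this is meant for r_1 + ... + r_k <= n.       *)
Definition extr (n k : nat) (r : 'I_k -> nat) (j : 'I_k.+1) : nat :=
  if unlift ord_max j is Some i then r i else (n - \sum_(i < k) r i)%N.

(* Main.v *)
(* Each identity is obtained by induction on k, splitting off the first part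
   r_1, from a two-variable q-Vandermonde formula
     F(x + y, n) = sum_r [n choose r]_q q^(e(x, y, r, n - r)) F(x, r) F(y, n - r),
   where F(x, n) is [x]_{n,q} or [x + n - 1]_{n,q}. These formulas follow by
   induction on n from [u + v]_q = [u]_q + q^u [v]_q, applied to the last factor
   of F(x + y, n + 1), and the q-Pascal rule; exchanging x and y turns the first
   identity into the third and the second into the fourth. *)
Require Import Defs.
From mathcomp Require Import all_boot all_order all_algebra.
From mathcomp Require Import boolp reals exp ring.

Set Implicit Arguments.
Unset Strict Implicit.
Unset Printing Implicit Defensive.

Import Order.TTheory GRing.Theory Num.Theory.
Local Open Scope ring_scope.

(** * Effect of splitting off $r_1$ and $x_1$ on $s_j$, $r_{k+1}$ and $z_j$ *)

Section SplitFirstPart.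
Variables (n k : nat) (r : 'I_k.+1 -> nat).
Let r' (i : 'I_k) := r (lift ord0 i).

Lemma psum_ord0 : psum r ord0 = r ord0.
Proof.
rewrite /psum (bigD1 ord0) //= big1 ?addn0 // => i /andP[].
by rewrite leqn0 -val_eqE /= => /eqP->.
Qed.

Lemma psum_lift0 (j : 'I_k) : psum r (lift ord0 j) = (r ord0 + psum r' j)%N.
Proof.
rewrite /psum big_mkcond big_ord_recl /=; congr (_ + _)%N.
by rewrite [RHS]big_mkcond.
Qed.

Lemma extr_ord0 : extr n r ord0 = r ord0.
Proof.
rewrite /extr; case: unliftP => [j j0|/eqP]; last by rewrite -val_eqE.
by congr (r _); apply: val_inj; move/(congr1 (@nat_of_ord _)): j0; rewrite lift_max.
Qed.

(** For the last part this is $n-(a+b)=(n-a)-b$, which truncated subtraction satisfies for all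
    naturals, so no bound on [r] is assumed. *)
Lemma extr_lift0 (j : 'I_k.+1) :
  extr n r (lift ord0 j) = extr (n - r ord0) r' j.
Proof.
rewrite /extr; case: (unliftP ord_max j) => [i ->|->].
  suff -> : lift ord0 (lift ord_max i) = lift ord_max (lift ord0 i) by rewrite liftK.
  by apply: ord_inj; rewrite lift0 !lift_max lift0.
suff -> : lift ord0 (ord_max : 'I_k.+1) = ord_max by rewrite unlift_none big_ord_recl subnDA.
exact: val_inj.
Qed.

End SplitFirstPart.

Section SplitFirstVariable.
Variables (R : realType) (k : nat) (x : 'I_k.+2 -> R).

Lemma tailsum_ord0 : tailsum x ord0 = \sum_(i < k.+1) x (lift ord0 i).
Proof. by rewrite /tailsum big_mkcond big_ord_recl /= add0r. Qed.

Lemma tailsum_lift0 (j : 'I_k) :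
  tailsum x (lift ord0 j) = tailsum (fun i => x (lift ord0 i)) j.
Proof. by rewrite /tailsum big_mkcond big_ord_recl /= add0r [RHS]big_mkcond. Qed.

End SplitFirstVariable.

(** * Sums over tuples, split by the first entry *)

Definition ffcons (T : finType) (k : nat) (t : T) (f : {ffun 'I_k -> T}) :
    {ffun 'I_k.+1 -> T} :=
  [ffun i => if unlift ord0 i is Some j then f j else t].

Lemma ffcons0 (T : finType) (k : nat) (t : T) (f : {ffun 'I_k -> T}) :
  ffcons t f ord0 = t.
Proof. by rewrite ffunE unlift_none. Qed.

Lemma ffconsS (T : finType) (k : nat) (t : T) (f : {ffun 'I_k -> T}) i :
  ffcons t f (lift ord0 i) = f i.
Proof. by rewrite ffunE liftK. Qed.

Lemma sum_ffcons (V : nmodType) (T : finType) (k : nat)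
    (P : pred {ffun 'I_k.+1 -> T}) (G : {ffun 'I_k.+1 -> T} -> V) :
  \sum_(r | P r) G r = \sum_t \sum_(f | P (ffcons t f)) G (ffcons t f).
Proof.
rewrite pair_big_dep /= (reindex (fun p => ffcons p.1 p.2)) //=.
exists (fun r => (r ord0, [ffun i => r (lift ord0 i)])) => [[t f] _|r _] /=.
  by rewrite ffcons0; congr pair; apply/ffunP => i; rewrite ffunE ffconsS.
apply/ffunP => i; rewrite [LHS]ffunE.
by case: unliftP => [j ->|->] //; rewrite ffunE.
Qed.

(** * $q$-numbers, $q$-factorials and $q$-binomial coefficients *)

Section QNumbers.
Variables (R : realType) (q : R).
Hypotheses (q_gt0 : 0 < q) (q_neq1 : q != 1).

Let powqD (x y : R) : q `^ (x + y) = q `^ x * q `^ y.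
Proof. by rewrite powRD // (gt_eqF q_gt0) implybT. Qed.

Let subq_neq0 : 1 - q != 0.
Proof. by rewrite subr_eq0 eq_sym. Qed.

Lemma qnumD (x y : R) : qnum q (x + y) = qnum q x + q `^ x * qnum q y.
Proof. by rewrite /qnum powqD; field. Qed.

Lemma qnum_nat_neq0 (n : nat) : qnum q n.+1%:R != 0.
Proof.
rewrite /qnum powR_mulrn ?ltW // mulf_neq0 ?invr_eq0 //.
by rewrite subr_eq0 eq_sym pexpr_eq1 ?ltW.
Qed.

Lemma qffactS (x : R) (n : nat) :
  qffact q x n.+1 = qffact q x n * qnum q (x - n%:R).
Proof. by rewrite /qffact big_nat_recr. Qed.

Lemma qffactD (x : R) (m n : nat) :
  qffact q x (m + n) = qffact q x m * qffact q (x - m%:R) n.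
Proof.
elim: n => [|n IHn]; first by rewrite addn0 /qffact [X in _ * X]big_geq ?mulr1.
by rewrite addnS !qffactS IHn natrD opprD addrA mulrA.
Qed.

(** Reversing the factors gives a product with fixed base $x$, so that passing to $n+1$ only appends
    a factor. *)
Lemma qrising_prod (x : R) (n : nat) :
  qffact q (x + n%:R - 1) n = \prod_(0 <= i < n) qnum q (x + i%:R).
Proof.
rewrite /qffact big_nat_rev; apply: eq_big_nat => i /andP[_ lt_in] /=.
congr (qnum q _); rewrite add0n natrB // -natr1; ring.
Qed.

Lemma qfactS (n : nat) : qfact q n.+1 = qfact q n * qnum q n.+1%:R.
Proof. by rewrite /qfact big_nat_recr. Qed.

Lemma qfact_neq0 (n : nat) : qfact q n != 0.
Proof.
elim: n => [|n IHn]; first by rewrite /qfact big_geq ?oner_neq0.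
by rewrite qfactS mulf_neq0 ?qnum_nat_neq0.
Qed.

Lemma qffact_nat (n : nat) : qffact q n%:R n = qfact q n.
Proof.
rewrite /qffact /qfact big_add1 /= big_nat_rev; apply: eq_big_nat => i /andP[_ lt_in].
congr (qnum q _); rewrite add0n natrB // -natr1; ring.
Qed.

Definition qbinom (n r : nat) : R := qffact q n%:R r / qfact q r.

Lemma qbinom0 (n : nat) : qbinom n 0 = 1.
Proof. by rewrite /qbinom /qffact /qfact !big_geq ?divr1. Qed.

(** For $r>n$ the product $[n]_{r,q}$ contains the factor $[n-n]_q=0$. *)
Lemma qbinom_small (n r : nat) : (n < r)%N -> qbinom n r = 0.
Proof.
move=> /subnKC <-; rewrite /qbinom addSnnS qffactD subrr.
rewrite [qffact q 0 _]/qffact big_nat_recl // subrr.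
by rewrite [qnum q 0]/qnum powRr0 subrr !(mul0r, mulr0).
Qed.

(** The Pascal rule comes from $[n+1]_q=[n-r]_q+q^{n-r}[r+1]_q$, applied to the first factor of
    $[n+1]_{r+1,q}=[n+1]_q[n]_{r,q}$. *)
Lemma qbinomS (n r : nat) : (r <= n)%N ->
  qbinom n.+1 r.+1 = qbinom n r.+1 + q `^ (n - r)%:R * qbinom n r.
Proof.
move=> le_rn; rewrite /qbinom qfactS [qffact q n%:R _]qffactS.
have -> : qffact q n.+1%:R r.+1 = qnum q n.+1%:R * qffact q n%:R r.
  by rewrite -(add1n r) qffactD {1}/qffact big_nat1 subr0 -natr1 addrK.
have -> : n.+1%:R = (n - r)%:R + r.+1%:R :> R by rewrite -natrD addnS subnK.
rewrite -natrB // qnumD.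
by field; rewrite qfact_neq0 qnum_nat_neq0.
Qed.

Lemma qbinom_sub (n r : nat) : (r <= n)%N -> qbinom n (n - r) = qbinom n r.
Proof.
have qbinomE m s : qbinom (m + s) m = qfact q (m + s) / (qfact q m * qfact q s).
  rewrite /qbinom -(qffact_nat (m + s)) qffactD natrD addrAC subrr add0r qffact_nat.
  by field; rewrite !qfact_neq0.
move=> le_rn; rewrite -{1 3}(subnKC le_rn) qbinomE {1}addnC qbinomE addnC.
by rewrite [X in _ / X]mulrC.
Qed.

(* All q-Vandermonde formulas are instances: the recurrence for [T] is what the
   splitting of a q-number by [qnumD] yields, and matches the Pascal rule. *)
Lemma qbinom_sum_recurrence (c t : nat -> R) (T : nat -> nat -> R) :
  c 0 = T 0 0 ->
  (forall n, c n.+1 = c n * t n) ->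
  (forall r m, T r m * t (r + m)%N = q `^ m%:R * T r.+1 m + T r m.+1) ->
  forall n, c n = \sum_(r < n.+1) qbinom n r * T r (n - r)%N.
Proof.
move=> c0 cS TS; elim=> [|n IHn].
  by rewrite big_ord_recl big_ord0 qbinom0 mul1r addr0.
rewrite cS IHn mulr_suml.
under eq_bigr => i _.
  rewrite -mulrA -[X in t X](subnKC (ltn_ord i : i <= n)%N) TS mulrDr.
  over.
rewrite big_split /= [RHS]big_ord_recl qbinom0 mul1r subn0.
under [in RHS]eq_bigr => i _.
  rewrite /= /bump /= add1n subSS qbinomS; last exact: (ltn_ord i).
  rewrite mulrDl [q `^ _ * _]mulrC -[X in _ + X]mulrA.
  over.
rewrite big_split /= addrA addrC; congr (_ + _).
(* The terms carrying a power of $q$ are matched. In the others the right side has one more index,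
   $r=n+1$, whose binomial coefficient vanishes. *)
rewrite big_ord_recl [in RHS]big_ord_recr /= (@qbinom_small n n.+1) // mul0r addr0.
rewrite qbinom0 mul1r subn0; congr (_ + _); apply: eq_bigr => i _.
by rewrite /= /bump /= add1n subnSK.
Qed.

(** * Two-variable $q$-Vandermonde formulas *)

Definition qvandermonde (F : R -> nat -> R) (e : R -> R -> R -> R -> R) :=
  forall x y n, F (x + y) n =
    \sum_(r < n.+1) qbinom n r *
      (q `^ e x y r%:R (n%:R - r%:R) * F x r * F y (n - r)%N).

(** Exchange $x$ and $y$, then substitute $n-r$ for $r$; the $q$-binomial coefficient is
    symmetric. *)
Lemma qvandermonde_sym F e : qvandermonde F e ->
  qvandermonde F (fun x y r m => e y x m r).
Proof.
move=> Fe x y n; rewrite addrC Fe (reindex_inj rev_ord_inj) /=.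
apply: eq_bigr => i _; rewrite subSS.
have le_in : (i <= n)%N by rewrite -ltnS.
by rewrite qbinom_sub // subKn // natrB // subKr [q `^ _ * _ * _]mulrAC.
Qed.

Lemma qffact_vandermonde :
  qvandermonde (fun x n => qffact q x n) (fun x _ r m => m * (x - r)).
Proof.
move=> x y n.
rewrite (@qbinom_sum_recurrence (qffact q (x + y)) (fun n => qnum q (x + y - n%:R))
  (fun r m => q `^ (m%:R * (x - r%:R)) * qffact q x r * qffact q y m)).
- by apply: eq_bigr => i _; rewrite natrB // -ltnS.
- by rewrite mul0r powRr0 /qffact !big_geq ?mulr1.
- by move=> m; rewrite qffactS.
move=> r m; rewrite !qffactS.
(* In this order $[x-r]_q$ extends the factorial of $x$ and yields $q^m$ [T r.+1 m], while
   $q^{x-r}[y-m]_q$ yields [T r m.+1]. *)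
have -> : x + y - (r + m)%:R = (x - r%:R) + (y - m%:R) by rewrite natrD; ring.
have -> : m%:R * (x - r%:R) = m%:R + m%:R * (x - r.+1%:R) by rewrite -natr1; ring.
have -> : m.+1%:R * (x - r%:R) = m%:R + m%:R * (x - r.+1%:R) + (x - r%:R).
  by rewrite -!natr1; ring.
by rewrite qnumD !powqD; ring.
Qed.

Lemma qrising_vandermonde :
  qvandermonde (fun x n => qffact q (x + n%:R - 1) n) (fun _ y r _ => r * y).
Proof.
move=> x y n; pose F z m := \prod_(0 <= i < m) qnum q (z + i%:R).
rewrite qrising_prod -/(F (x + y) n).
have FS z m : F z m.+1 = F z m * qnum q (z + m%:R) by rewrite /F big_nat_recr.
rewrite (@qbinom_sum_recurrence (F (x + y)) (fun n => qnum q (x + y + n%:R))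
  (fun r m => q `^ (r%:R * y) * F x r * F y m)).
- by apply: eq_bigr => i _; rewrite !qrising_prod.
- by rewrite mul0r powRr0 /F !big_geq ?mulr1.
- by move=> m; rewrite FS.
move=> r m; rewrite !FS.
(* Here the part with $y$ comes first: $[y+m]_q$ yields [T r m.+1], and $q^{y+m}[x+r]_q$ yields
   $q^m$ [T r.+1 m]. *)
have -> : x + y + (r + m)%:R = (y + m%:R) + (x + r%:R) by rewrite natrD; ring.
have -> : r.+1%:R * y = r%:R * y + y by rewrite -natr1; ring.
by rewrite qnumD !powqD; ring.
Qed.

(** * From two variables to $k+1$ variables *)

Lemma qmultinom_split (n k : nat) (r : 'I_k.+1 -> nat) : (r ord0 <= n)%N ->
  qmultinom q n%:R r =
  qbinom n (r ord0) * qmultinom q (n - r ord0)%:R (fun i => r (lift ord0 i)).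
Proof.
move=> le_rn; rewrite /qmultinom /qbinom !big_ord_recl qffactD -natrB //.
by rewrite invfM mulrACA.
Qed.

(* The parts are bounded by a fixed [N >= n], so that removing the first part
   [r_1] and replacing [n] by [n - r_1] leaves the index type unchanged. *)
Lemma qvandermonde_multi F e : qvandermonde F e ->
  forall (N k n : nat) (x : 'I_k.+1 -> R), (n <= N)%N ->
  F (\sum_(j < k.+1) x j) n =
    \sum_(r : {ffun 'I_k -> 'I_N.+1} | (\sum_(i < k) r i <= n)%N)
      qmultinom q n%:R (fun i => r i)
      * q `^ (\sum_(j < k) e (x (widen_ord (leqnSn k) j)) (tailsum x j) (r j)%:R
                             (n%:R - (psum (fun i => r i) j)%:R))
      * \prod_(j < k.+1) F (x j) (extr n (fun i => r i) j).
Proof.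
move=> Fe N; elim=> [|k IHk] n x le_nN.
  (* With no free part the only index is the empty function, and the single remaining part is
     $n$. *)
  rewrite (big_pred1 [ffun _ => ord0]); last first.
    move=> r; rewrite big_ord0 /=; apply/esym/eqP/ffunP; by case.
  rewrite /qmultinom !big_ord0 !big_ord1 /qffact big_geq // divr1 powRr0 !mul1r.
  have -> : ord0 = ord_max :> 'I_1 by apply: val_inj.
  by rewrite /extr unlift_none big_ord0 subn0.
(* The two-variable formula is applied to $x_1$ and $z_1$; its sum is then widened to the range of
   $r_1$, up to [N]. *)
rewrite big_ord_recl Fe (big_ord_widen N.+1 (fun r => qbinom n r *
  (q `^ e _ _ r%:R (n%:R - r%:R) * F _ r * F _ (n - r)%N))) //.
rewrite sum_ffcons big_mkcond; apply: eq_bigr => t _; rewrite ltnS.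
have tail f : (fun i => (ffcons t f (lift ord0 i) : nat)) = (fun i : 'I_k => f i : nat).
  by apply: funext => i; rewrite ffconsS.
have sumE f : (\sum_(i < k.+1) ffcons t f i = t + \sum_(i < k) f i)%N.
  by rewrite big_ord_recl ffcons0; congr (_ + _)%N; apply: eq_bigr => i _; rewrite ffconsS.
(* If $r_1>n$, no choice of the other parts meets the bound and the inner sum is empty. *)
case: leqP => [le_tn|lt_nt]; last first.
  rewrite big1 // => f; rewrite sumE => /(leq_trans (leq_addr _ _)).
  by rewrite leqNgt lt_nt.
rewrite (IHk _ (fun i => x (lift ord0 i))); last exact: leq_trans (leq_subr _ _) le_nN.
rewrite !mulr_sumr; apply: eq_big => [f|f _]; first by rewrite sumE leq_subRL.
rewrite qmultinom_split ffcons0 // tail [X in _ = _ * q `^ X * _]big_ord_recl [X in _ = _ * X]big_ord_recl.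
rewrite extr_ord0 tailsum_ord0 psum_ord0 ffcons0 powqD.
have -> : widen_ord (leqnSn k.+1) ord0 = ord0 by apply: val_inj.
(* The later exponents agree because $n-(r_1+s'_j)=(n-r_1)-s'_j$, where $s'_j$ are the partial sums
   of the remaining parts. *)
under [X in _ = _ * (_ * q `^ X) * _]eq_bigr => j _.
  rewrite tailsum_lift0 psum_lift0 tail ffconsS ffcons0 natrD opprD addrA -natrB //.
  have -> : widen_ord (leqnSn k.+1) (lift ord0 j) = lift ord0 (widen_ord (leqnSn k) j).
    exact: val_inj.
  over.
under [X in _ = _ * (_ * X)]eq_bigr => j _ do rewrite extr_lift0 tail ffcons0.
by ring.
Qed.

End QNumbers.

Theorem theorem2p1 (R : realType) (k n : nat) (hk : (0 < k)%N) (hn : (0 < n)%N)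
    (x : 'I_k.+1 -> R) (q : R) (hq0 : 0 < q) (hq1 : q != 1) :
  [/\ qffact q (\sum_(j < k.+1) x j) n =
        \sum_(r : {ffun 'I_k -> 'I_n.+1} | (\sum_(i < k) r i <= n)%N)
          qmultinom q n%:R (fun i => r i)
          * q `^ (\sum_(j < k) (n%:R - (psum (fun i => r i) j)%:R) * (x (widen_ord (leqnSn k) j) - (r j)%:R))
          * \prod_(j < k.+1) qffact q (x j) (extr n (fun i => r i) j),
      qffact q (\sum_(j < k.+1) x j + n%:R - 1) n =
        \sum_(r : {ffun 'I_k -> 'I_n.+1} | (\sum_(i < k) r i <= n)%N)
          qmultinom q n%:R (fun i => r i)
          * q `^ (\sum_(j < k) (r j)%:R * tailsum x j)
          * \prod_(j < k.+1) qffact q (x j + (extr n (fun i => r i) j)%:R - 1) (extr n (fun i => r i) j),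
      qffact q (\sum_(j < k.+1) x j) n =
        \sum_(r : {ffun 'I_k -> 'I_n.+1} | (\sum_(i < k) r i <= n)%N)
          qmultinom q n%:R (fun i => r i)
          * q `^ (\sum_(j < k) (r j)%:R * (tailsum x j - (n%:R - (psum (fun i => r i) j)%:R)))
          * \prod_(j < k.+1) qffact q (x j) (extr n (fun i => r i) j)
    & qffact q (\sum_(j < k.+1) x j + n%:R - 1) n =
        \sum_(r : {ffun 'I_k -> 'I_n.+1} | (\sum_(i < k) r i <= n)%N)
          qmultinom q n%:R (fun i => r i)
          * q `^ (\sum_(j < k) x (widen_ord (leqnSn k) j) * (n%:R - (psum (fun i => r i) j)%:R))
          * \prod_(j < k.+1) qffact q (x j + (extr n (fun i => r i) j)%:R - 1) (extr n (fun i => r i) j)].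
Proof.
have vdm := qffact_vandermonde hq0 hq1.
have vdm' := qrising_vandermonde hq0 hq1.
have vdm'_sym : qvandermonde q (fun x n => qffact q (x + n%:R - 1) n) (fun x _ _ m => x * m).
  move=> y z m; rewrite (qvandermonde_sym hq0 hq1 vdm').
  by apply: eq_bigr => i _; rewrite [_ * y]mulrC.
split.
(* In each case [N] is $n$, and the exponent is $e(x_j,z_j,r_j,n-s_j)$ summed over $j$. *)
- exact: (qvandermonde_multi hq0 vdm).
- exact: (qvandermonde_multi hq0 vdm').
- exact: (qvandermonde_multi hq0 (qvandermonde_sym hq0 hq1 vdm)).
- exact: (qvandermonde_multi hq0 vdm'_sym).
Qed.
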